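(* Let $d\in\{2,3\}$ and $n\ge d$. Let $\{c_i\}_{i=1}^n$ be a positive sequence that is regular with respect to $d$. For unit vectors $g_1,\dots,g_n\in\mathbb{R}^d$ let $G=\sum_{i=1}^n c_i^2 g_ig_i^T$. Then $$\|G\|^2\ \ge\ \frac1d\left(\sum_{i=1}^n c_i^2\right)^2 ,$$ and this lower bound is achieved by $\{g_i\}_{i=1}^n$ (i.e. equality holds) if and only if $$\sum_{i=1}^n c_i^2 g_ig_i^T=\frac1d\sum_{i=1}^n c_i^2\, I_d .$$
   Context: $\|\cdot\|$ is the Frobenius norm of a matrix; $I_d$ is the $d\times d$ identity matrix. A positive sequence $\{c_i\}_{i=1}^n$ with $n\ge d$ is called regular (with respect to $d$) if $\max_{j=1,\dots,n} c_j^2\le \frac1d\sum_{i=1}^n c_i^2$. *)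

(* Defs.v *)
From mathcomp Require Import all_boot all_order all_algebra.
From mathcomp Require Import reals.

Set Implicit Arguments.
Unset Strict Implicit.
Unset Printing Implicit Defensive.

Import Order.TTheory GRing.Theory Num.Theory.

Local Open Scope ring_scope.

(* Frobenius norm; on a column vector it is the Euclidean norm. The norm that
   MathComp-Analysis puts on matrices is the max norm, hence this definition. *)
Definition frobenius_norm (R : realType) (p q : nat) (A : 'M[R]_(p, q)) : R :=
  Num.sqrt (\sum_(i < p) \sum_(j < q) A i j ^+ 2).

Definition unit_vector (R : realType) (d : nat) (v : 'cV[R]_d) : Prop :=
  frobenius_norm v = 1.

(* Starting the maximum at 0 is harmless for a nonempty family of squares. *)
Definition regular_seq (R : realType) (d n : nat) (c : 'I_n -> R) : Prop :=
  \big[Num.max/0]_(j < n) (c j ^+ 2) <= d%:R^-1 * \sum_(i < n) c i ^+ 2.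

Definition frame_operator (R : realType) (d n : nat)
    (c : 'I_n -> R) (g : 'I_n -> 'cV[R]_d) : 'M[R]_d :=
  \sum_(i < n) c i ^+ 2 *: (g i *m (g i)^T).

(* Main.v *)
(** Since [\tr G = \sum_i c_i ^+ 2], both claims express that [G - (\tr G / d) I]
    has nonnegative squared norm [||G||^2 - (\tr G)^2 / d], which vanishes only
    when [G] is that multiple of the identity. *)

Require Import Defs.
From mathcomp Require Import all_boot all_order all_algebra.
From mathcomp Require Import reals.
From mathcomp Require Import ring.

Set Implicit Arguments.
Unset Strict Implicit.
Unset Printing Implicit Defensive.

Import Order.TTheory GRing.Theory Num.Theory.

Local Open Scope ring_scope.

Lemma sqr_frobenius_norm (R : realType) (p q : nat) (A : 'M[R]_(p, q)) :
  frobenius_norm A ^+ 2 = \sum_(i < p) \sum_(j < q) A i j ^+ 2.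
Proof.
by rewrite sqr_sqrtr // sumr_ge0 // => i _; rewrite sumr_ge0 // => j _; exact: sqr_ge0.
Qed.

(** The trace form is bilinear, so squared norms of differences can be expanded; on a column vector
    it also evaluates the trace of a rank-one projector. *)
Lemma sqr_frobenius_norm_tr (R : realType) (p q : nat) (A : 'M[R]_(p, q)) :
  frobenius_norm A ^+ 2 = \tr (A *m A^T).
Proof.
rewrite sqr_frobenius_norm; apply: eq_bigr => i _.
by rewrite mxE; apply: eq_bigr => j _; rewrite mxE expr2.
Qed.

Lemma frobenius_norm_eq0 (R : realType) (p q : nat) (A : 'M[R]_(p, q)) :
  frobenius_norm A ^+ 2 = 0 -> A = 0.
Proof.
rewrite sqr_frobenius_norm => A0; apply/matrixP => i j; rewrite mxE.
have row_ge0 k : 0 <= \sum_(l < q) A k l ^+ 2.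
  by rewrite sumr_ge0 // => l _; exact: sqr_ge0.
have rowi0 : \sum_(l < q) A i l ^+ 2 = 0.
  exact: (psumr_eq0P (fun k _ => row_ge0 k) A0).
apply/eqP; rewrite -sqrf_eq0; apply/eqP.
exact: (psumr_eq0P (fun l _ => sqr_ge0 (A i l)) rowi0).
Qed.

(** Pythagoras for the trace inner product: the subtracted matrix is the orthogonal projection of
    [A] onto the line spanned by the identity. *)
Lemma sqr_frobenius_norm_sub_scalar (R : realType) (d : nat) (A : 'M[R]_d) :
  (0 < d)%N ->
  frobenius_norm (A - (d%:R^-1 * \tr A) *: 1%:M) ^+ 2
    = frobenius_norm A ^+ 2 - d%:R^-1 * \tr A ^+ 2.
Proof.
move=> d_gt0; have d_neq0 : d%:R != 0 :> R by rewrite pnatr_eq0 -lt0n.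
rewrite !sqr_frobenius_norm_tr scalemx1 linearB /= tr_scalar_mx.
rewrite mulmxBl !mulmxBr mul_mx_scalar !mul_scalar_mx.
(* With [s = d%:R^-1 * \tr A], the two cross terms total [- 2 * s * \tr A] and the scalar part gives
   [s ^+ 2 * d%:R]. *)
rewrite !linearB /= !linearZ /= mxtrace_tr mxtrace_scalar -mulr_natr.
by field.
Qed.

Lemma mxtrace_frame_operator (R : realType) (d n : nat)
    (c : 'I_n -> R) (g : 'I_n -> 'cV[R]_d) :
  (forall i, unit_vector (g i)) ->
  \tr (frame_operator c g) = \sum_(i < n) c i ^+ 2.
Proof.
move=> g_unit; rewrite /frame_operator raddf_sum; apply: eq_bigr => i _ /=.
(* The trace of [g i *m (g i)^T] is the squared length of [g i], namely 1. *)
by rewrite mxtraceZ -sqr_frobenius_norm_tr g_unit expr1n mulr1.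
Qed.

Theorem mainTheorem2 (R : realType) (d n : nat)
    (hd : d = 2%N \/ d = 3%N) (hn : (d <= n)%N)
    (c : 'I_n -> R) (c_gt0 : forall i : 'I_n, 0 < c i)
    (c_regular : regular_seq d c)
    (g : 'I_n -> 'cV[R]_d) (g_unit : forall i : 'I_n, unit_vector (g i)) :
  d%:R^-1 * (\sum_(i < n) c i ^+ 2) ^+ 2
    <= frobenius_norm (frame_operator c g) ^+ 2 /\
  (frobenius_norm (frame_operator c g) ^+ 2
     = d%:R^-1 * (\sum_(i < n) c i ^+ 2) ^+ 2 <->
   frame_operator c g = (d%:R^-1 * \sum_(i < n) c i ^+ 2) *: 1%:M).
Proof.
have d_gt0 : (0 < d)%N by case: hd => ->.
have := sqr_frobenius_norm_sub_scalar (frame_operator c g) d_gt0.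
rewrite mxtrace_frame_operator // => normB; split.
  by rewrite -subr_ge0 -normB sqr_ge0.
split=> [normG | G_scalar].
  by apply/subr0_eq/frobenius_norm_eq0; rewrite normB normG subrr.
(* Read backwards, [normB] turns the gap in the inequality into the squared norm of a deviation that
   [G_scalar] makes zero. *)
apply/subr0_eq; rewrite -normB G_scalar subrr sqr_frobenius_norm_tr.
by rewrite mul0mx mxtrace0.
Qed.
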